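(* Let $\delta\in\mathbb{C}$ with $\delta\neq-\tfrac12$ and $\delta\neq 1$, and let $L$ be a $\delta$-Lie algebra over $\mathbb{C}$. Then $L$ is a $2$-step nilpotent algebra.
   Context: An algebra means a complex vector space with a bilinear multiplication, not assumed associative. A $\delta$-Lie algebra is an anticommutative algebra ($xy=-yx$) satisfying $(xy)z=\delta\big((xz)y+x(yz)\big)$ for all $x,y,z$. An algebra is called $2$-step nilpotent if $(xy)z=0$ and $x(yz)=0$ for all $x,y,z$. *)

(* Defs.v *)
From HB Require Import structures.
From mathcomp Require Import all_boot all_order all_algebra.
From mathcomp Require Import sesquilinear complex.
From mathcomp Require Import reals.

Set Implicit Arguments.
Unset Strict Implicit.
Unset Printing Implicit Defensive.

Import Order.TTheory GRing.Theory Num.Theory.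

Local Open Scope ring_scope.

(* A (not necessarily associative) K-algebra, of arbitrary dimension, is an
   lmodType K together with a bilinear multiplication.  The algType and lalgType
   of ssralg are associative and unital, hence not suitable here.  The field of
   complex numbers is R[i] for R : realType. *)

Definition delta_Lie (K : fieldType) (delta : K) (L : lmodType K)
    (mul : {bilinear L -> L -> L}) : Prop :=
  (forall x y : L, mul x y = - mul y x) /\
  (forall x y z : L,
     mul (mul x y) z = delta *: (mul (mul x z) y + mul x (mul y z))).

(* The vanishing of all products of three elements; algebras with zero
   multiplication are included. *)
Definition two_step_nilpotent (K : fieldType) (L : lmodType K)
    (mul : {bilinear L -> L -> L}) : Prop :=
  forall x y z : L, mul (mul x y) z = 0 /\ mul x (mul y z) = 0.

(* Main.v *)
Require Import Defs.
From HB Require Import structures.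
From mathcomp Require Import all_boot all_order all_algebra.
From mathcomp Require Import sesquilinear complex.
From mathcomp Require Import reals.

Set Implicit Arguments.
Unset Strict Implicit.
Unset Printing Implicit Defensive.

Import Order.TTheory GRing.Theory Num.Theory.

Local Open Scope ring_scope.

(** By anticommutativity the [delta]-Lie identity relates only the three cyclic
    products [a = (xy)z], [b = (yz)x] and [c = (zx)y]: it reads
    [a = - delta (b + c)], together with its cyclic permutations.  This is a
    homogeneous linear system whose circulant matrix has eigenvalues
    [1 - delta] (twice, on vectors of sum zero) and [1 + 2 delta] (on the
    diagonal).  Both are nonzero under the hypotheses, so every [(xy)z]
    vanishes, and then so does [x(yz) = - (yz)x].  The system is
    [delta_Lie_cyclic], and its triviality is [cyclic_system_eq0]. *)

Lemma delta_Lie_cyclic (K : fieldType) (delta : K) (L : lmodType K)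
    (mul : {bilinear L -> L -> L}) (x y z : L) :
  delta_Lie delta mul ->
  mul (mul x y) z = - delta *: (mul (mul y z) x + mul (mul z x) y).
Proof.
move=> [anti jac].
by rewrite jac (anti x z) (anti x (mul y z)) linearNl -opprD scalerN scaleNr addrC.
Qed.

(** Subtracting two equations gives [(1 - delta) (a - b) = 0], hence
    [a = b = c]; the first equation then becomes [(1 + 2 delta) a = 0]. *)
Lemma cyclic_system_eq0 (K : fieldType) (delta : K) (V : lmodType K)
    (a b c : V) :
  delta != 1 -> 1 + delta *+ 2 != 0 ->
  a = - delta *: (b + c) -> b = - delta *: (c + a) -> c = - delta *: (a + b) ->
  a = 0.
Proof.
move=> d1 d2 ha hb hc.
have eq_of_swap (u v w : V) :
    u = - delta *: (v + w) -> v = - delta *: (w + u) -> u = v.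
  move=> hu hv; apply/eqP; rewrite -subr_eq0.
  have : (1 - delta) *: (u - v) = 0.
    rewrite scalerBl scale1r {1}hu {2}hv -scalerBr addrKA.
    by rewrite scaleNr -scalerN opprB subrr.
  by move/eqP; rewrite scaler_eq0 (subr_eq0 1) (eq_sym 1) (negPf d1).
have ab := eq_of_swap _ _ _ ha hb.
have bc := eq_of_swap _ _ _ hb hc.
have : (1 + delta *+ 2) *: a = 0.
  rewrite scalerDl scale1r {1}ha -bc -ab -mulr2n scaleNr.
  by rewrite -scalerMnr scalerMnl addNr.
by move/eqP; rewrite scaler_eq0 (negPf d2) => /eqP.
Qed.

Theorem lemma5 (R : realType) (delta : R[i])
    (hdelta_half : delta <> - (1 / 2)) (hdelta_one : delta <> 1)
    (L : lmodType R[i]) (mul : {bilinear L -> L -> L})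
    (hL : delta_Lie delta mul) :
  two_step_nilpotent mul.
Proof.
have d1 : delta != 1 by apply/eqP.
have d2 : 1 + delta *+ 2 != 0.
  apply/eqP => h; apply: hdelta_half.
  have two_neq0 : (2 : R[i]) != 0 by rewrite pnatr_eq0.
  apply: (mulIf two_neq0); rewrite mulNr divfK // mulr_natr.
  by apply/eqP; rewrite -addr_eq0 addrC h.
have left0 x y z : mul (mul x y) z = 0.
  by apply: (cyclic_system_eq0 d1 d2); apply: delta_Lie_cyclic hL.
by move=> x y z; split; [|rewrite hL.1]; rewrite left0 ?oppr0.
Qed.
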